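(* For each positive integer $n$, let $g(n)$ be the product of all prime powers at most $n$. Let $G$ be a finite group and let $m$ be a positive integer such that $|A| \leq m$ for every abelian subgroup $A$ of $G$. Then $|G|$ divides $g(m)$.
   Context: A prime power is an integer of the form $p^k$ with $p$ prime and $k \geq 1$. Thus $g(n)=\prod_{p^k\le n,\ k\ge 1} p^k$, with $g(1)=1$ (empty product); for example $g(4)=2\cdot 3\cdot 4=24$. *)

(* Defs.v *)
From mathcomp Require Import all_boot all_fingroup.

Set Implicit Arguments.
Unset Strict Implicit.
Unset Printing Implicit Defensive.

(* The bounds p, k <= q lose nothing (see prime_powerP). *)
Definition prime_power (q : nat) : bool :=
  [exists p : 'I_q.+1, exists k : 'I_q.+1, [&& prime p, 0 < k & q == p ^ k]].

Lemma prime_powerP (q : nat) :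
  reflect (exists p k : nat, [/\ prime p, 0 < k & q = p ^ k]) (prime_power q).
Proof.
apply: (iffP existsP) => [[p /existsP[k /and3P[pp k0 /eqP qE]]]|].
  by exists (p : nat), (k : nat).
move=> [p [k [pp k0 qE]]].
have lep : p < q.+1 by rewrite ltnS qE -{1}(expn1 p) leq_exp2l ?prime_gt1.
have lek : k < q.+1 by rewrite ltnS qE ltnW // ltn_expl // prime_gt1.
exists (Ordinal lep); apply/existsP; exists (Ordinal lek).
by rewrite /= pp k0 qE eqxx.
Qed.

(* Each prime power q <= n is taken once, itself, as a factor; this is not the
   lcm of 1, ..., n. *)
Definition g (n : nat) : nat := \prod_(1 <= q < n.+1 | prime_power q) q.

Lemma g1 : g 1 = 1.
Proof.
rewrite /g big_nat_cond big1 // => q /andP[/andP[q1 q2] _].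
by apply/eqP; rewrite eqn_leq q1 -ltnS q2.
Qed.

Lemma g4 : g 4 = 24.
Proof.
have E1 : prime_power 1 = false.
  apply/negbTE/negP => /prime_powerP[p [k [pp k0 E]]].
  by have := ltn_expl k (prime_gt1 pp); rewrite -E ltnS leqNgt k0.
have E2 : prime_power 2 by apply/prime_powerP; exists 2, 1.
have E3 : prime_power 3 by apply/prime_powerP; exists 3, 1.
have E4 : prime_power 4 by apply/prime_powerP; exists 2, 2.
by rewrite /g unlock /= E1 E2 E3 E4.
Qed.

(* Main.v *)
Require Import Defs.
From mathcomp Require Import all_boot all_fingroup.
From mathcomp Require Import all_solvable.

(** The divisibility is checked one prime p at a time, on a Sylow p-subgroup P
    of G, where it says that logn p #|P| is at most the sum of all i with
    p ^ i <= m.  The p-group contributes a large abelian subgroup: a maximal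
    normal abelian subgroup A of P is its own centraliser, so P / A acts
    faithfully on A.  A p-group acting on a group of order p ^ k fixes a series
    of subgroups with factors of order p and acts trivially on each factor.
    Picking one element in each layer of the series gives generators whose
    orbits have sizes at most 1, p, ..., p ^ (k - 1), so the acting group modulo
    its kernel has order at most p ^ (0 + 1 + ... + (k - 1))
    ([index_cent_pgroup]).
    Thus a group A of order p ^ k forces #|P| <= p ^ (1 + 2 + ... + k)
    ([pgroup_abelian_bound]).  As p ^ k <= m, the factors p, p ^ 2, ..., p ^ k
    all occur in the product g m ([dvdn_g_expn_bin2]). *)

Set Implicit Arguments.
Unset Strict Implicit.
Unset Printing Implicit Defensive.

(** The powers p, p ^ 2, ..., p ^ k are distinct factors of g m, and their
    exponents add up to 'C(k.+1, 2). *)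
Lemma dvdn_g_expn_bin2 (p k m : nat) :
  prime p -> p ^ k <= m -> p ^ 'C(k.+1, 2) %| g m.
Proof.
move=> p_pr le_pk_m; have p_gt1 := prime_gt1 p_pr.
pose S := [seq p ^ i | i <- index_iota 1 k.+1].
have -> : (p ^ 'C(k.+1, 2) = \prod_(q <- S) q)%N.
  by rewrite -bin2_sum expn_sum big_map big_ltn // expn0 mul1n.
rewrite /g [X in _ %| X](bigID (fun q => q \in S)) /= dvdn_mulr //.
rewrite -[X in _ %| X]big_filter [X in _ %| X](perm_big S) //.
apply: uniq_perm => [||q].
- exact/filter_uniq/iota_uniq.
- by rewrite map_inj_uniq ?iota_uniq //; apply: expnI.
rewrite mem_filter -andbA; apply/and3P/idP=> [[]|Sq] //; split=> //.
  have /mapP[i] := Sq; rewrite mem_index_iota => /andP[i_gt0 _] ->.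
  by apply/prime_powerP; exists p, i.
have /mapP[i] := Sq; rewrite !mem_index_iota !ltnS => /andP[_ le_ik] ->.
by rewrite expn_gt0 prime_gt0 //= (leq_trans _ le_pk_m) ?leq_exp2l.
Qed.

Import GroupScope.

(** A / B has prime order, so a nontrivial intersection with the centre of the
    p-group P / B, which nilpotency provides, must be all of A / B. Hence P acts
    trivially on A / B. *)
Lemma class_sub_lcoset_prime_index (gT : finGroupType) (p : nat)
    (P A B : {group gT}) (a : gT) :
    p.-group P -> A <| P -> B <| P -> B \subset A -> prime #|A : B| ->
    a \in A ->
  a ^: P \subset a *: B.
Proof.
move=> pP nsAP nsBP sBA prAB Aa; have [sAP _] := andP nsAP.
have [sBP nBP] := andP nsBP; have nBA := subset_trans sAP nBP.
have sABZ : A / B \subset 'Z(P / B).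
  apply: prime_meetG; first by rewrite card_quotient.
  apply: meet_center_nil; rewrite ?quotient_normal //.
    exact/(pgroup_nil (p := p))/quotient_pgroup.
  by rewrite -cardG_gt1 card_quotient // prime_gt1.
apply/subsetP=> _ /imsetP[x Px ->]; rewrite mem_lcoset -/([~ a, x]).
have nBa := subsetP nBA a Aa; have nBx := subsetP nBP x Px.
apply: coset_idr; first by rewrite groupR.
rewrite morphR //=; apply/eqP/commgP.
exact/commute_sym/(centerC (mem_quotient B Px))/(subsetP sABZ)/mem_quotient.
Qed.

(** The bound is the order of the group of unitriangular k by k matrices
    over the field with p elements.  Given
    a P-invariant subgroup B of index p in A and a in A outside B, an element
    that centralises B and a centralises A; so passing from the centraliser of B
    to that of A costs at most the number of conjugates of a, and these lie in
    the coset a B, of size p ^ (k - 1). *)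
Lemma index_cent_pgroup (gT : finGroupType) (p k : nat) (P A : {group gT}) :
    prime p -> p.-group P -> A <| P -> #|A| = (p ^ k)%N ->
  #|P : 'C_P(A)| <= p ^ 'C(k, 2).
Proof.
move=> p_pr pP; elim: k => [|k IHk] in A * => nsAP oA.
  by rewrite (card1_trivg oA) cent1T setIT indexgg.
have [|B [sBA nsBP oB]] := normal_pgroup (r := k) pP nsAP.
  by rewrite oA pfactorK.
have iAB : #|A : B| = p by rewrite -divgS // oA oB expnS mulnK ?expn_gt0 ?prime_gt0.
have prAB : prime #|A : B| by rewrite iAB.
have /subsetPn[a Aa nBa] : ~~ (A \subset B).
  by rewrite -indexg_eq1 iAB neq_ltn prime_gt1 ?orbT.
have sCaC : 'C_('C_P(B))[a] \subset 'C_P(A).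
  rewrite -setIA setIS //.
  (* B is maximal in A, having prime index, so B and a generate A. *)
  have -> : A :=: B <*> <[a]>.
    have [_ maxB] := maxgroupP (p_index_maximal sBA prAB).
    apply/eqP; rewrite eqEsubset join_subG sBA cycle_subG Aa !andbT.
    apply: contraR nBa => nsA.
    have <- : (B <*> <[a]>)%G = B :> {set gT}.
      by apply: maxB; rewrite ?joing_subl // /proper join_subG sBA cycle_subG Aa.
    by rewrite -cycle_subG joing_subr.
  by rewrite centY cent_cycle.
have sCC : 'C_P(A) \subset 'C_P(B) by rewrite setIS // centS.
rewrite -(Lagrange_index (subsetIl P 'C(B)) sCC) binS bin1 expnD leq_mul ?IHk //.
apply: leq_trans (_ : #|'C_P(B) : 'C_('C_P(B))[a]| <= _).
  exact/dvdn_leq/indexgS.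
rewrite index_cent1 -oB -(card_lcoset B a); apply: subset_leq_card.
have := class_sub_lcoset_prime_index pP nsAP nsBP sBA prAB Aa.
exact/subset_trans/imsetS/subsetIl.
Qed.

Lemma pgroup_abelian_bound (gT : finGroupType) (p : nat) (P : {group gT}) :
    prime p -> p.-group P ->
  exists (A : {group gT}) (k : nat),
    [/\ A \subset P, abelian A, #|A| = (p ^ k)%N & #|P| <= p ^ 'C(k.+1, 2)].
Proof.
move=> p_pr pP.
have [|A maxA _] := @maxgroup_exists _ (fun A => (A <| P) && abelian A) 1%G.
  by rewrite normal1 abelian1.
have SCN_A := max_SCN pP maxA; have [nsAP scA] := SCN_P SCN_A.
have sAP := normal_sub nsAP; have oA := card_pgroup (pgroupS sAP pP).
exists A, (logn p #|A|); split=> //; first exact: SCN_abelian SCN_A.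
rewrite -(Lagrange sAP) {1}oA binS bin1 addnC expnD leq_mul2l -[in #|P : _|]scA.
by rewrite index_cent_pgroup ?orbT.
Qed.

Theorem theorem2p1 (gT : finGroupType) (G : {group gT}) (m : nat)
  (m_gt0 : 0 < m)
  (abelian_le_m : forall A : {group gT}, A \subset G -> abelian A -> #|A| <= m) :
  #|G| %| g m.
Proof.
apply/dvdn_partP=> // p; rewrite mem_primes => /andP[p_pr _].
have [P sylP] := Sylow_exists p G; have [sPG pP _] := and3P sylP.
have [A [k [sAP cAA oA oP_le]]] := pgroup_abelian_bound p_pr pP.
have le_pk_m : p ^ k <= m by rewrite -oA abelian_le_m // (subset_trans sAP).
apply: dvdn_trans (dvdn_g_expn_bin2 p_pr le_pk_m).
rewrite -(card_Hall sylP) (card_pgroup pP) dvdn_exp2l //.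
by rewrite -(leq_exp2l _ _ (prime_gt1 p_pr)) -(card_pgroup pP).
Qed.
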